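(* Let $\mathcal{S}$ be a non-empty closed subset of the space $\mathcal{G}$ of marked finitely generated groups. If every non-empty open subset of $\mathcal{S}$ (in the subspace topology) contains at least two non-quasi-isometric groups, then $\mathcal{S}$ is quasi-isometrically diverse.
   Context: Space of marked groups: for $n\in\mathbb{N}=\{1,2,\ldots\}$ let $\mathcal{G}_n$ be the set of all pairs $(G,X)$, where $G$ is a group generated by an ordered $n$-tuple $X\in G^n$, up to the equivalence: $(G,(x_1,\ldots,x_n))$ and $(H,(y_1,\ldots,y_n))$ are equivalent if the map $x_i\mapsto y_i$ extends to an isomorphism $G\to H$. Associating to $(G,X)$ the kernel of the homomorphism $F_n\to G$ sending a fixed basis of the free group $F_n$ to $X$ identifies $\mathcal{G}_n$ with the set of normal subgroups of $F_n$; $\mathcal{G}_n$ carries the topology induced by the product topology on $2^{F_n}$. The map $(G,(x_1,\ldots,x_n))\mapsto(G,(x_1,\ldots,x_n,1))$ identifies $\mathcal{G}_n$ with a clopen subspace of $\mathcal{G}_{n+1}$, and $\mathcal{G}=\bigcup_{n\in\mathbb{N}}\mathcal{G}_n$ is the topological union: $U\subseteq\mathcal{G}$ is open if and only if $U=\bigcup_n U_n$ with each $U_n$ open in $\mathcal{G}_n$. Quasi-isometry: metric spaces $(S,d_S)$, $(T,d_T)$ are quasi-isometric if there are a constant $C$ and maps $\varphi\colon S\to T$, $\psi\colon T\to S$ such that $d_T(\varphi(x),\varphi(y))\le C d_S(x,y)+C$ for all $x,y\in S$, $d_S(\psi(x),\psi(y))\le C d_T(x,y)+C$ for all $x,y\in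 T$, $\sup_{t\in T}d_T(\varphi(\psi(t)),t)\le C$ and $\sup_{s\in S}d_S(\psi(\varphi(s)),s)\le C$. Marked groups $(G,X)$, $(H,Y)$ are quasi-isometric if $G$ and $H$ with the word metrics with respect to $X$ and $Y$ are quasi-isometric. A subset of a topological space is comeagre if it is the intersection of countably many subsets with dense interiors. A subset $\mathcal{S}\subseteq\mathcal{G}$ is quasi-isometrically diverse if every comeagre subset of $\mathcal{S}$ (with the subspace topology) has $2^{\aleph_0}$ quasi-isometry classes, i.e. contains groups from $2^{\aleph_0}$ distinct quasi-isometry classes. *)

(* Defs.v *)
From HB Require Import structures.
From mathcomp Require Import all_boot all_order all_algebra.
From mathcomp Require Import all_classical all_reals all_analysis.
From mathcomp Require Import zify.

Set Implicit Arguments.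
Unset Strict Implicit.
Unset Printing Implicit Defensive.

Import Order.TTheory GRing.Theory Num.Theory.

Local Open Scope classical_set_scope.
Local Open Scope quotient_scope.
Local Open Scope card_scope.
Local Open Scope group_scope.

(* The letter (i, true) stands for the generator i, (i, false) for its inverse. *)
Definition word (I : Type) := seq (I * bool).

Definition letter_inv {I : Type} (a : I * bool) : I * bool := (a.1, ~~ a.2).

Definition word_inv {I : Type} (w : word I) : word I := rev (map letter_inv w).

Inductive free_eq {I : Type} : word I -> word I -> Prop :=
| free_refl u : free_eq u u
| free_sym u v : free_eq u v -> free_eq v u
| free_trans v u w : free_eq u v -> free_eq v w -> free_eq u w
| free_cancel u v a : free_eq (u ++ a :: letter_inv a :: v) (u ++ v).

Section FreeGroup.
Variable I : choiceType.
Implicit Types u v w : word I.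

Definition free_rel : rel (word I) := fun u v => `[< free_eq u v >].

Lemma free_rel_equiv : equiv_class_of free_rel.
Proof.
split=> [u|u v|v u w].
- by apply/asboolP; exact: free_refl.
- by apply/asboolP/asboolP; exact: free_sym.
- by move=> /asboolP uv /asboolP vw; apply/asboolP; exact: free_trans uv vw.
Qed.

Canonical free_equiv_rel := EquivRelPack free_rel_equiv.

Definition free_group := {eq_quot free_equiv_rel}.
HB.instance Definition _ := Choice.on free_group.

Definition free_of_word (w : word I) : free_group := \pi_{eq_quot free_equiv_rel} w.

Lemma free_of_wordE u v : free_of_word u = free_of_word v <-> free_eq u v.
Proof.
rewrite /free_of_word; split=> [/eqmodP/asboolP//|uv].
by apply/eqmodP/asboolP.
Qed.

Lemma free_reprK w : free_eq (repr (free_of_word w)) w.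
Proof. by apply/free_of_wordE; rewrite /free_of_word reprK. Qed.

Lemma free_of_wordK (x : free_group) : free_of_word (repr x) = x.
Proof. exact: reprK. Qed.

Lemma letter_invK : involutive (@letter_inv I).
Proof. by move=> [i b]; rewrite /letter_inv /= negbK. Qed.

Lemma free_eq_cat u u' v v' :
  free_eq u u' -> free_eq v v' -> free_eq (u ++ v) (u' ++ v').
Proof.
move=> uu vv; apply: (@free_trans _ (u' ++ v)).
  elim: uu => {u u'} [u|u u' _|u' u u'' _ IH1 _ IH2|u u' a].
  - exact: free_refl.
  - exact: free_sym.
  - exact: free_trans IH1 IH2.
  - by rewrite -!catA /=; exact: free_cancel.
elim: vv => {v v'} [v|v v' _|v' v v'' _ IH1 _ IH2|v v' a].
- exact: free_refl.
- exact: free_sym.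
- exact: free_trans IH1 IH2.
- by rewrite !catA; exact: free_cancel.
Qed.

Lemma free_eq_inv u v : free_eq u v -> free_eq (word_inv u) (word_inv v).
Proof.
elim=> {u v} [u|u v _|v u w _ IH1 _ IH2|u v a].
- exact: free_refl.
- exact: free_sym.
- exact: free_trans IH1 IH2.
- rewrite /word_inv !map_cat !rev_cat /= !rev_cons letter_invK -!cats1.
  rewrite -!catA /=; exact: free_cancel.
Qed.

Lemma word_invK : involutive (@word_inv I).
Proof.
move=> u; rewrite /word_inv map_rev revK -map_comp -[RHS]map_id.
by apply: eq_map => a /=; exact: letter_invK.
Qed.

Lemma free_eq_mulV u : free_eq (u ++ word_inv u) [::].
Proof.
elim: u => [|a u IH]; first exact: free_refl.
have -> : (a :: u) ++ word_inv (a :: u)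
    = [:: a] ++ (u ++ word_inv u) ++ [:: letter_inv a].
  by rewrite /word_inv /= rev_cons -cats1 catA.
apply: (@free_trans _ ([:: a] ++ [::] ++ [:: letter_inv a])).
  apply: free_eq_cat; first exact: free_refl.
  by apply: free_eq_cat => //; exact: free_refl.
exact: (@free_cancel _ [::] [::]).
Qed.

Definition free_one : free_group := free_of_word [::].
Definition free_inv (x : free_group) : free_group :=
  free_of_word (word_inv (repr x)).
Definition free_mul (x y : free_group) : free_group :=
  free_of_word (repr x ++ repr y).

Lemma free_mulE u v :
  free_mul (free_of_word u) (free_of_word v) = free_of_word (u ++ v).
Proof. by apply/free_of_wordE; apply: free_eq_cat; exact: free_reprK. Qed.

Lemma free_invE u : free_inv (free_of_word u) = free_of_word (word_inv u).
Proof. by apply/free_of_wordE; apply: free_eq_inv; exact: free_reprK. Qed.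

Lemma free_mulA : associative free_mul.
Proof.
move=> x y z; rewrite -(free_of_wordK x) -(free_of_wordK y) -(free_of_wordK z).
by rewrite !free_mulE catA.
Qed.

Lemma free_mul1 : left_id free_one free_mul.
Proof. by move=> x; rewrite -(free_of_wordK x) free_mulE. Qed.

Lemma free_mulr1 : right_id free_one free_mul.
Proof. by move=> x; rewrite -(free_of_wordK x) free_mulE cats0. Qed.

Lemma free_mulV : right_inverse free_one free_inv free_mul.
Proof.
move=> x; rewrite -(free_of_wordK x) free_invE free_mulE.
by apply/free_of_wordE; exact: free_eq_mulV.
Qed.

Lemma free_mulVl : left_inverse free_one free_inv free_mul.
Proof.
move=> x; rewrite -(free_of_wordK x) free_invE free_mulE.
apply/free_of_wordE; rewrite -{2}(word_invK (repr x)); exact: free_eq_mulV.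
Qed.

HB.instance Definition _ := isGroup.Build free_group
  free_mulA free_mul1 free_mulr1 free_mulVl free_mulV.

Definition free_gen (i : I) : free_group := free_of_word [:: (i, true)].

End FreeGroup.

Section Eval.
Variables (I : Type) (G : groupType) (X : I -> G).

Definition letter_eval (a : I * bool) : G := if a.2 then X a.1 else (X a.1)^-1.

Definition word_eval (w : word I) : G := \prod_(a <- w) letter_eval a.

Definition generates := forall g : G, exists w, word_eval w = g.

Lemma letter_evalV a : letter_eval (letter_inv a) = (letter_eval a)^-1.
Proof. by case: a => i []; rewrite /letter_eval //= invgK. Qed.

Lemma word_eval_cat u v : word_eval (u ++ v) = word_eval u * word_eval v.
Proof. by rewrite /word_eval big_cat. Qed.

Lemma word_eval_free_eq u v : free_eq u v -> word_eval u = word_eval v.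
Proof.
elim=> {u v} [//|u v _ -> //|v u w _ -> _ -> //|u v a].
rewrite !word_eval_cat /word_eval !big_cons letter_evalV.
by rewrite (mulgA (letter_eval a)) mulgV mul1g.
Qed.

End Eval.

Section FreeEval.
Variables (I : choiceType) (G : groupType) (X : I -> G).

Definition free_eval (x : free_group I) : G := word_eval X (repr x).

Lemma free_eval_word w : free_eval (free_of_word w) = word_eval X w.
Proof. by apply: word_eval_free_eq; exact: free_reprK. Qed.

Lemma free_eval_gen i : free_eval (free_gen i) = X i.
Proof. by rewrite free_eval_word /word_eval big_seq1. Qed.

Lemma free_eval_monoid_morphism : monoid.monoid_morphism free_eval.
Proof.
split=> [|x y]; first by rewrite free_eval_word /word_eval big_nil.
rewrite -[x]free_of_wordK -[y]free_of_wordK [X in free_eval X]free_mulE.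
by rewrite !free_eval_word word_eval_cat.
Qed.

HB.instance Definition _ :=
  isUMagmaMorphism.Build (free_group I) G free_eval free_eval_monoid_morphism.

End FreeEval.

Section Normal.
Variable G : groupType.

Record normal_subgroup := NormalSubgroup {
  nsub :> G -> bool;
  nsub1 : nsub 1;
  nsubM : forall x y, nsub x -> nsub y -> nsub (x * y);
  nsubV : forall x, nsub x -> nsub x^-1;
  nsubJ : forall x y, nsub x -> nsub (x ^ y)
}.

Lemma normal_subgroupP (M N : normal_subgroup) : M =1 N -> M = N.
Proof.
case: M N => M m1 mM mV mJ [N n1 nM nV nJ] /= /funext MN.
by subst N; congr NormalSubgroup; exact: Prop_irrelevance.
Qed.

HB.instance Definition _ := gen_eqMixin normal_subgroup.
HB.instance Definition _ := gen_choiceMixin normal_subgroup.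

(* The topology induced by the product topology on 2^G, with bool discrete. *)
HB.instance Definition _ := Topological.copy normal_subgroup
  (initial_topology (nsub : normal_subgroup -> {ptws G -> bool})).

Variable N : normal_subgroup.

Definition coset_rel : rel G := fun x y => N (x^-1 * y).

Lemma coset_rel_equiv : equiv_class_of coset_rel.
Proof.
have cs x y : coset_rel x y -> coset_rel y x.
  by move=> /(@nsubV N); rewrite /coset_rel invgM invgK.
split=> [x|x y|y x z].
- by rewrite /coset_rel mulVg nsub1.
- by apply/idP/idP; exact: cs.
- rewrite /coset_rel => xy yz.
  by have := nsubM xy yz; rewrite -mulgA mulVKg.
Qed.

Canonical coset_equiv_rel := EquivRelPack coset_rel_equiv.

Definition quotient_group := {eq_quot coset_equiv_rel}.
HB.instance Definition _ := Choice.on quotient_group.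

Definition coset (x : G) : quotient_group := \pi_{eq_quot coset_equiv_rel} x.

Lemma coset_eqP x y : coset x = coset y <-> N (x^-1 * y).
Proof. by split=> [/eqmodP //|xy]; apply/eqmodP. Qed.

Lemma coset_reprK (a : quotient_group) : coset (repr a) = a.
Proof. exact: reprK. Qed.

Definition quotient_one : quotient_group := coset 1.
Definition quotient_mul (a b : quotient_group) := coset (repr a * repr b).
Definition quotient_inv (a : quotient_group) := coset (repr a)^-1.

Lemma quotient_mulE x y : quotient_mul (coset x) (coset y) = coset (x * y).
Proof.
have rK z : N ((repr (coset z))^-1 * z) by apply/coset_eqP; rewrite coset_reprK.
apply/coset_eqP; set x' := repr _; set y' := repr _.
have -> : (x' * y')^-1 * (x * y) = ((x'^-1 * x) ^ y') * (y'^-1 * y).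
  by rewrite conjgE invgM -!mulgA mulVKg.
by apply: nsubM; [apply: nsubJ|]; exact: rK.
Qed.

Lemma quotient_invE x : quotient_inv (coset x) = coset x^-1.
Proof.
have rK z : N ((repr (coset z))^-1 * z) by apply/coset_eqP; rewrite coset_reprK.
apply/coset_eqP; set x' := repr _; rewrite invgK.
have -> : x' * x^-1 = ((x'^-1 * x)^-1) ^ x^-1.
  by rewrite conjgE !invgM !invgK mulgA mulgA mulgV mul1g.
by apply/nsubJ/nsubV; exact: rK.
Qed.

Lemma quotient_mulA : associative quotient_mul.
Proof.
move=> a b c; rewrite -(coset_reprK a) -(coset_reprK b) -(coset_reprK c).
by rewrite !quotient_mulE mulgA.
Qed.

Lemma quotient_mul1 : left_id quotient_one quotient_mul.
Proof. by move=> a; rewrite -(coset_reprK a) quotient_mulE mul1g. Qed.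

Lemma quotient_mulr1 : right_id quotient_one quotient_mul.
Proof. by move=> a; rewrite -(coset_reprK a) quotient_mulE mulg1. Qed.

Lemma quotient_mulVl : left_inverse quotient_one quotient_inv quotient_mul.
Proof.
by move=> a; rewrite -(coset_reprK a) quotient_invE quotient_mulE mulVg.
Qed.

Lemma quotient_mulV : right_inverse quotient_one quotient_inv quotient_mul.
Proof.
by move=> a; rewrite -(coset_reprK a) quotient_invE quotient_mulE mulgV.
Qed.

HB.instance Definition _ := isGroup.Build quotient_group
  quotient_mulA quotient_mul1 quotient_mulr1 quotient_mulVl quotient_mulV.

Lemma coset_monoid_morphism : monoid.monoid_morphism coset.
Proof. by split=> // x y; rewrite [RHS]quotient_mulE. Qed.

HB.instance Definition _ :=
  isUMagmaMorphism.Build G quotient_group coset coset_monoid_morphism.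

Lemma coset1P x : coset x = 1 <-> N x.
Proof.
rewrite -[1]/(coset 1); split=> [/esym/coset_eqP|Nx].
  by rewrite invg1 mul1g.
by apply/esym/coset_eqP; rewrite invg1 mul1g.
Qed.

End Normal.

(* The class of a marked group (G, X) in G_n is represented by the kernel of
   F_n -> G; conversely N represents (F_n / N, images of the basis). *)
Definition marked (n : nat) := normal_subgroup (free_group 'I_n).
HB.instance Definition _ n := Topological.on (marked n).

Section Kernel.
Variables (n : nat) (G : groupType) (X : 'I_n -> G).

Let ker (x : free_group 'I_n) : bool := free_eval X x == 1.

Let ker1 : ker 1. Proof. by rewrite /ker gmulf1. Qed.

Let kerM x y : ker x -> ker y -> ker (x * y).
Proof. by rewrite /ker gmulfM /= => /eqP-> /eqP->; rewrite mulg1. Qed.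

Let kerV x : ker x -> ker x^-1.
Proof. by rewrite /ker gmulfV /= => /eqP->; rewrite invg1. Qed.

Let kerJ x y : ker x -> ker (x ^ y).
Proof. by rewrite /ker gmulfJ /= => /eqP->; rewrite conj1g. Qed.

Definition marked_of : marked n := NormalSubgroup ker1 kerM kerV kerJ.

Lemma marked_ofE x : marked_of x = (free_eval X x == 1).
Proof. by []. Qed.

End Kernel.

Definition marked_group n (N : marked n) : groupType := quotient_group N.

Definition marking n (N : marked n) (i : 'I_n) : marked_group N :=
  coset N (free_gen i).

Lemma free_eval_comp (I : choiceType) (G H : groupType) (X : I -> G)
    (f : monoid.UMagmaMorphism.type G H) x :
  free_eval (f \o X) x = f (free_eval X x).
Proof.
rewrite /free_eval /word_eval; elim: (repr x) => [|a w IH].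
  by rewrite !big_nil gmulf1.
rewrite !big_cons gmulfM IH; congr (_ * _).
by case: a => i []; rewrite /letter_eval //= gmulfV.
Qed.

Lemma free_eval_id (I : choiceType) (x : free_group I) :
  free_eval (@free_gen I) x = x.
Proof.
rewrite /free_eval -[RHS]free_of_wordK; elim: (repr x) => [|a w IH].
  by rewrite /word_eval big_nil.
rewrite /word_eval big_cons -/(word_eval _ _) IH -cat1s.
rewrite -[RHS]free_mulE; congr (_ * _).
by case: a => i [] //; rewrite /letter_eval /= [LHS]free_invE.
Qed.

Lemma free_eval_marking n (N : marked n) x :
  free_eval (marking N) x = coset N x.
Proof. by rewrite (free_eval_comp _ (coset N)) free_eval_id. Qed.

Lemma marking_generates n (N : marked n) : generates (marking N).
Proof.
by move=> g; exists (repr (repr g)); rewrite -[LHS]/(free_eval _ _)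
  free_eval_marking [LHS]coset_reprK.
Qed.

Lemma marked_ofK n (N : marked n) : marked_of (marking N) = N.
Proof.
apply: normal_subgroupP => x; rewrite marked_ofE free_eval_marking.
by apply/eqP/idP => /coset1P.
Qed.

(* Two marked groups determine the same point of G_n if and only if they are
   equivalent. *)
Lemma marked_of_eqP n (G H : groupType) (X : 'I_n -> G) (Y : 'I_n -> H) :
  generates X -> generates Y ->
  marked_of X = marked_of Y <->
  exists f : G -> H, [/\ bijective f, {morph f : x y / x * y} &
    forall i, f (X i) = Y i].
Proof.
move=> gX gY; split=> [XY|[f [bf fM fX]]]; last first.
  have f1 : f 1 = 1 by apply: (mulgI (f 1)); rewrite -fM !mulg1.
  pose F : monoid.UMagmaMorphism.type G H := HB.pack f
    (monoid.isUMagmaMorphism.Build G H f (f1, fM)).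
  apply: normal_subgroupP => x; rewrite !marked_ofE.
  have -> : Y = F \o X by apply/funext => i /=; rewrite fX.
  by rewrite free_eval_comp -f1 (inj_eq (bij_inj bf)).
have kerE w w' : word_eval X w = word_eval X w' <-> word_eval Y w = word_eval Y w'.
  have E (K : groupType) (Z : 'I_n -> K) : word_eval Z w = word_eval Z w' <->
      marked_of Z ((free_of_word w)^-1 * free_of_word w').
    rewrite marked_ofE gmulfM gmulfV /= !free_eval_word; split=> [->|/eqP e].
      by rewrite mulVg.
    by rewrite -[LHS]mulg1 -e mulVKg.
  by rewrite !E XY.
have [wX wXE] := choice gX; have [wY wYE] := choice gY.
exists (fun g => word_eval Y (wX g)); split.
- by exists (fun h => word_eval X (wY h)) => z;
    [rewrite -[RHS]wXE; apply/kerE | rewrite -[RHS]wYE; apply/kerE];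
    rewrite ?wXE ?wYE.
- by move=> x y; rewrite -word_eval_cat; apply/kerE; rewrite word_eval_cat !wXE.
- move=> i; have Z (K : groupType) (Z : 'I_n -> K) : Z i = word_eval Z [:: (i, true)].
    by rewrite /word_eval big_seq1.
  by rewrite [RHS]Z; apply/kerE; rewrite wXE Z.
Qed.

(* (x_1, ..., x_n) becomes (x_1, ..., x_n, 1, ..., 1) when n <= m. *)
Definition pad (G : groupType) n m (X : 'I_n -> G) (i : 'I_m) : G :=
  oapp X 1 (insub (i : nat)).

Definition stabilize n m (N : marked n) : marked m := marked_of (pad (marking N)).

Lemma pad_comp (G H : groupType) n m (X : 'I_n -> G)
    (f : monoid.UMagmaMorphism.type G H) :
  @pad H n m (f \o X) = f \o pad X.
Proof.
by apply/funext => i; rewrite /pad /=; case: insub => //=; rewrite gmulf1.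
Qed.

Lemma stabilize_marked_of (G : groupType) n m (X : 'I_n -> G) :
  stabilize m (marked_of X) = marked_of (pad X).
Proof.
apply: normal_subgroupP => x; rewrite !marked_ofE.
rewrite pad_comp free_eval_comp; set y := free_eval _ x.
have -> : free_eval (pad X) x = free_eval X y.
  rewrite -free_eval_comp -pad_comp; congr (free_eval (pad _) x).
  by apply/funext => i /=; rewrite free_eval_gen.
by rewrite -marked_ofE; apply/eqP/idP => /coset1P.
Qed.

Lemma pad_pad (G : groupType) n m k (X : 'I_n -> G) :
  minn n k <= m -> @pad G m k (pad X) = pad X.
Proof.
move=> nkm; apply/funext => i; rewrite /pad.
case: (@insubP _ (fun j => j < m) _ (i : nat)) => [j _ /= -> //|].
rewrite -leqNgt => mi; case: insubP => //= j jn.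
by move: (ltn_ord i) nkm => ik; rewrite geq_min; lia.
Qed.

Lemma stabilize_stabilize n m k (N : marked n) :
  minn n k <= m -> stabilize k (stabilize m N) = stabilize k N.
Proof. by move=> nkm; rewrite stabilize_marked_of pad_pad. Qed.

Lemma pad_id (G : groupType) n (X : 'I_n -> G) : pad X = X.
Proof. by apply/funext => i; rewrite /pad valK. Qed.

Lemma stabilize_id n (N : marked n) : stabilize n N = N.
Proof. by rewrite /stabilize pad_id marked_ofK. Qed.

(* The disjoint union of the G_n, n >= 1: (n, N) has N in G_(n+1). *)
Definition premarked := {n : nat & marked n.+1}.
HB.instance Definition _ := Topological.on premarked.


Lemma continuous_nsub (G : groupType) (x : G) :
  continuous (fun N : normal_subgroup G => N x).
Proof.
move=> N.
apply: (@continuous_comp _ {ptws G -> bool} _ (@nsub G) (@proj _ (fun=> bool) x)).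
  exact: initial_continuous.
exact: proj_continuous.
Qed.

Lemma continuous_to_nsub (T : topologicalType) (G : groupType)
    (f : T -> normal_subgroup G) :
  (forall x, continuous (fun t => f t x)) -> continuous f.
Proof.
move=> fc; apply: continuous_comp_initial => t.
apply/cvg_sup => x; move: t.
apply/(@continuousP _ (initial_topology (@^~ x))) => A [B oB <-].
rewrite -comp_preimage.
by move: B oB; exact/continuousP/fc.
Qed.

Lemma stabilizeE n m (N : marked n) x :
  stabilize m N x = N (free_eval (pad (@free_gen 'I_n)) x).
Proof.
rewrite marked_ofE pad_comp free_eval_comp.
by apply/eqP/idP => /coset1P.
Qed.

Lemma stabilize_continuous n m : continuous (@stabilize n m).
Proof.
apply: continuous_to_nsub => x.
under eq_fun do rewrite stabilizeE.
exact: continuous_nsub.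
Qed.

(* Points of G_n and G_m are identified when they agree in G_(max(n, m)). *)
Definition premarked_rel : rel premarked := fun p q =>
  let k := maxn (projT1 p).+1 (projT1 q).+1 in
  stabilize k (projT2 p) == stabilize k (projT2 q).

Lemma premarked_relP (p q : premarked) k :
  (projT1 p < k)%N -> (projT1 q < k)%N ->
  premarked_rel p q <-> stabilize k (projT2 p) = stabilize k (projT2 q).
Proof.
move=> pk qk; rewrite /premarked_rel; set l := maxn _ _.
have lk : (l <= k)%N by rewrite geq_max pk.
split=> [/eqP e|e].
  rewrite -(@stabilize_stabilize _ l k); last by rewrite /l; lia.
  by rewrite e stabilize_stabilize //; rewrite /l; lia.
apply/eqP; rewrite -(@stabilize_stabilize _ k l); last by lia.
by rewrite e stabilize_stabilize //; lia.
Qed.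

Lemma premarked_rel_equiv : equiv_class_of premarked_rel.
Proof.
split=> [p|p q|q p r].
- exact: eqxx.
- by rewrite /premarked_rel maxnC eq_sym.
- pose k := maxn (projT1 p).+1 (maxn (projT1 q).+1 (projT1 r).+1).
  move=> /(@premarked_relP _ _ k) pq /(@premarked_relP _ _ k) qr.
  apply/(@premarked_relP _ _ k); rewrite ?/k; [lia|lia|].
  by rewrite pq ?qr //; lia.
Qed.

Canonical premarked_equiv_rel := EquivRelPack premarked_rel_equiv.

(* The final topology for the inclusions of the G_n; see [open_marked_spaceP]. *)
Definition marked_space := quotient_topology {eq_quot premarked_equiv_rel}.
HB.instance Definition _ := Topological.on marked_space.

Definition embed n (N : marked n.+1) : marked_space :=
  \pi_{eq_quot premarked_equiv_rel} (existT _ n N).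

Lemma embed_eqP n m (N : marked n.+1) (M : marked m.+1) :
  embed N = embed M <-> 
  stabilize (maxn n.+1 m.+1) N = stabilize (maxn n.+1 m.+1) M.
Proof. by split=> [/eqmodP/eqP //|e]; apply/eqmodP/eqP. Qed.

Lemma embed_repr (x : marked_space) : embed (projT2 (repr x)) = x.
Proof.
by rewrite /embed; case E : (repr x) => [n N] /=; rewrite -E; exact: reprK.
Qed.

Lemma embed_inj n : injective (@embed n).
Proof. by move=> N M /embed_eqP; rewrite maxnn !stabilize_id. Qed.

Lemma embed_continuous n : continuous (@embed n).
Proof.
apply/continuousP => A oA.
have {}oA : open ((\pi_{eq_quot premarked_equiv_rel} : premarked -> _) @^-1` A) by [].
by have /sigT_openP := oA; apply.
Qed.

Lemma embed_open n (U : set (marked n.+1)) : open U -> open (@embed n @` U).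
Proof.
move=> oU; apply/sigT_openP => m.
have -> : existT _ m @^-1` (\pi_{eq_quot premarked_equiv_rel} @^-1` (@embed n @` U))
    = stabilize n.+1 @^-1` U `&`
      [set M : marked m.+1 | forall i : 'I_m.+1, (n < i)%N ==> M (free_gen i)].
  apply/seteqP; split=> M /=.
  - move=> [N UN] /embed_eqP E.
    have EN : N = stabilize n.+1 M.
      rewrite -[LHS]stabilize_id -(@stabilize_stabilize _ (maxn n.+1 m.+1)); last lia.
      by rewrite E stabilize_stabilize //; lia.
    split; first by rewrite -EN.
    move=> i; apply/implyP => ni.
    have -> : M = stabilize m.+1 N.
      rewrite -[LHS]stabilize_id -(@stabilize_stabilize _ (maxn n.+1 m.+1)); last lia.
      by rewrite -E stabilize_stabilize //; lia.
    rewrite marked_ofE free_eval_gen /pad insubF ?eqxx //=.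
    by apply/negbTE; rewrite -leqNgt.
  - move=> [UM Mi]; exists (stabilize n.+1 M) => //.
    apply/embed_eqP.
    have MM : stabilize m.+1 (stabilize n.+1 M) = M.
      rewrite /stabilize -/(stabilize _ _) stabilize_marked_of -[RHS]marked_ofK.
      congr marked_of; apply/funext => i; rewrite /pad.
      case: (@insubP _ (fun j => j < n.+1)%N _ (i : nat)) => [j _ /= ji|/=].
        by rewrite ji valK.
      rewrite -leqNgt => ni; apply/esym/coset1P.
      by have /implyP := Mi i; apply.
    have [nm|mn] := leqP n m.
      by rewrite -[in RHS]MM [RHS]stabilize_stabilize //; lia.
    have -> : maxn n.+1 m.+1 = n.+1 by lia.
    by rewrite stabilize_id.
apply: openI; first by move: U oU; apply/continuousP; exact: stabilize_continuous.
rewrite openE => M /= Mi; rewrite /interior.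
apply: (@filter_forall _ _ (fun i : 'I_m.+1 =>
  [set N : marked m.+1 | (n < i)%N ==> N (free_gen i)]) (nbhs M)) => i.
apply: (@filterS _ (nbhs M) _ [set N : marked m.+1 | N (free_gen i) = M (free_gen i)]).
  by move=> N /= ->; exact: Mi.
exact: (@continuous_nsub _ (free_gen i) M [set b | b = M (free_gen i)]).
Qed.

Lemma open_marked_spaceP (U : set marked_space) :
  open U <-> exists2 V : forall n, set (marked n.+1),
    forall n, open (V n) & U = \bigcup_n (@embed n @` V n).
Proof.
split=> [oU|[V oV ->]]; last by apply: bigcup_open => n _; exact: embed_open.
exists (fun n => @embed n @^-1` U).
  by move=> n; move: U oU; apply/continuousP; exact: embed_continuous.
apply/seteqP; split=> [x Ux|x [n _ [N UN <-]] //].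
by exists (projT1 (repr x)) => //; exists (projT2 (repr x)) => /=; rewrite embed_repr.
Qed.

Definition quasi_isometric (R : realType) (S T : Type)
    (dS : S -> S -> R) (dT : T -> T -> R) : Prop :=
  exists (C : R) (phi : S -> T) (psi : T -> S),
    [/\ forall x y, (dT (phi x) (phi y) <= C * dS x y + C)%R,
        forall x y, (dS (psi x) (psi y) <= C * dT x y + C)%R,
        forall t, (dT (phi (psi t)) t <= C)%R &
        forall s, (dS (psi (phi s)) s <= C)%R].

Section WordMetric.
Variables (I : Type) (G : groupType) (X : I -> G).

(* k is the least length of a word representing g. *)
Definition is_word_norm (g : G) (k : nat) : Prop :=
  (exists2 w, word_eval X w = g & size w = k) /\
  (forall w, word_eval X w = g -> (k <= size w)%N).

(* Defaults to 0 when g is not in the subgroup generated by X. *)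
Definition word_norm (g : G) : nat := xget 0%N [set k | is_word_norm g k].

Definition word_dist (R : realType) (g h : G) : R := (word_norm (g^-1 * h))%:R%R.

Lemma word_norm_unique g k : is_word_norm g k -> word_norm g = k.
Proof.
move=> gk; have := @xgetPex _ 0%N [set k | is_word_norm g k] (ex_intro _ k gk).
rewrite -/(word_norm g) => -[[w wg ws] wm] ; case: gk => [[v vg vs] vm].
by apply/eqP; rewrite eqn_leq -{1}vs -{2}ws wm // vm.
Qed.

Lemma word_normP g : generates X -> is_word_norm g (word_norm g).
Proof.
move=> gX; suff [k gk] : exists k, is_word_norm g k by rewrite (word_norm_unique gk).
have ex : exists k, `[< exists2 w, word_eval X w = g & size w = k >].
  by have [w wg] := gX g; exists (size w); apply/asboolP; exists w.
exists (ex_minn ex); case: ex_minnP => k /asboolP kw km.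
by split=> // w wg; apply: km; apply/asboolP; exists w.
Qed.

End WordMetric.

Definition marked_dist (R : realType) n (N : marked n) :
  marked_group N -> marked_group N -> R := word_dist (marking N) R.

(* Independent of the chosen representatives, by [marked_space_qiE]. *)
Definition marked_space_qi (R : realType) (x y : marked_space) : Prop :=
  quasi_isometric (@marked_dist R _ (projT2 (repr x)))
                  (@marked_dist R _ (projT2 (repr y))).

Lemma word_norm_pad (G : groupType) n m (X : 'I_n -> G) g :
  (n <= m)%N -> generates X -> word_norm (@pad G n m X) g = word_norm X g.
Proof.
move=> nm gX; apply: word_norm_unique.
have [[w wg ws] wm] := word_normP g gX; split.
  exists (map (fun a => (widen_ord nm a.1, a.2)) w); last by rewrite size_map.
  rewrite -wg /word_eval big_map; apply: eq_bigr => -[i b] _.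
  by rewrite /letter_eval /= /pad /= valK.
move=> v vg.
pose t (a : 'I_m * bool) : option ('I_n * bool) :=
  omap (fun i => (i, a.2)) (insub (a.1 : nat)).
apply: (@leq_trans (size (pmap t v))); last by rewrite size_pmap count_size.
apply: wm; rewrite -vg {vg}; elim: v => [|[i b] v IH]; first by rewrite /word_eval !big_nil.
rewrite /word_eval big_cons /= -!/(word_eval _ _) -IH /t /letter_eval /= /pad.
case: insub => [j|] /=; first by rewrite /word_eval big_cons.
by case: b; rewrite ?invg1 mul1g.
Qed.

Lemma word_norm_morph (G H : groupType) (I : Type) (X : I -> G) (f : G -> H) g :
  injective f -> {morph f : x y / x * y} -> generates X ->
  word_norm (f \o X) (f g) = word_norm X g.
Proof.
move=> fI fM gX.
have f1 : f 1 = 1 by apply: (mulgI (f 1)); rewrite -fM !mulg1.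
have fV x : f x^-1 = (f x)^-1.
  by apply: (mulgI (f x)); rewrite -fM !mulgV.
have fw w : word_eval (f \o X) w = f (word_eval X w).
  rewrite /word_eval; elim: w => [|[i b] w IH]; first by rewrite !big_nil f1.
  by rewrite !big_cons fM IH /letter_eval /=; case: b; rewrite ?fV.
apply: word_norm_unique; have [[w wg ws] wm] := word_normP g gX.
split; first by exists w => //; rewrite fw wg.
by move=> v; rewrite fw => /fI /wm.
Qed.

Lemma quasi_isometric_isometry (R : realType) (S S' T T' : Type)
    (dS : S -> S -> R) (dS' : S' -> S' -> R)
    (dT : T -> T -> R) (dT' : T' -> T' -> R) (f : S -> S') (g : T -> T') :
  bijective f -> (forall x y, dS' (f x) (f y) = dS x y) ->
  bijective g -> (forall x y, dT' (g x) (g y) = dT x y) ->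
  quasi_isometric dS dT -> quasi_isometric dS' dT'.
Proof.
move=> [f' fK f'K] fd [g' gK g'K] gd [C [phi [psi [H1 H2 H3 H4]]]].
have fd' x y : dS (f' x) (f' y) = dS' x y by rewrite -fd !f'K.
have gd' x y : dT (g' x) (g' y) = dT' x y by rewrite -gd !g'K.
exists C, (g \o phi \o f'), (f \o psi \o g'); split=> [x y|x y|t|s] /=.
- by rewrite gd -fd'.
- by rewrite fd -gd'.
- by rewrite fK -{2}(g'K t) gd.
- by rewrite gK -{2}(f'K s) fd.
Qed.

Lemma embed_isometry (R : realType) n m (N : marked n.+1) (M : marked m.+1) :
  embed N = embed M -> exists2 f : marked_group N -> marked_group M,
    bijective f & forall x y, marked_dist R (f x) (f y) = marked_dist R x y.
Proof.
move=> /embed_eqP; set k := maxn _ _ => E.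
have gpad l (L : marked l) : (l <= k)%N -> generates (@pad _ _ k (marking L)).
  move=> lk g; have [w wg] := @marking_generates _ L g.
  exists (map (fun a => (widen_ord lk a.1, a.2)) w).
  rewrite -wg /word_eval big_map; apply: eq_bigr => -[i b] _.
  by rewrite /letter_eval /= /pad /= valK.
have nk : (n.+1 <= k)%N by rewrite /k; lia.
have mk : (m.+1 <= k)%N by rewrite /k; lia.
have [+ _] := marked_of_eqP (gpad _ N nk) (gpad _ M mk).
move=> /(_ E) [f [bf fM fX]]; exists f => // x y.
have fV z : f z^-1 = (f z)^-1.
  apply: (mulgI (f z)); rewrite -fM !mulgV.
  by apply: (mulgI (f 1)); rewrite -fM !mulg1.
rewrite /marked_dist /word_dist -fV -fM; congr (_%:R)%R.
rewrite -(word_norm_pad _ mk) ?marking_generates //; last exact: marking_generates.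
rewrite -(word_norm_pad _ nk); last exact: marking_generates.
have <- : f \o @pad _ _ k (marking N) = @pad _ _ k (marking M).
  by apply/funext => i /=; rewrite fX.
by apply: word_norm_morph => //; [exact: bij_inj|exact: gpad].
Qed.

Lemma marked_space_qiE (R : realType) n m (N : marked n.+1) (M : marked m.+1) :
  marked_space_qi R (embed N) (embed M) <->
  quasi_isometric (@marked_dist R _ N) (@marked_dist R _ M).
Proof.
have [f bf fd] := embed_isometry R (embed_repr (embed N)).
have [g bg gd] := embed_isometry R (embed_repr (embed M)).
have [f' bf' fd'] := embed_isometry R (esym (embed_repr (embed N))).
have [g' bg' gd'] := embed_isometry R (esym (embed_repr (embed M))).
by split; [exact: quasi_isometric_isometry bf fd bg gd
          |exact: quasi_isometric_isometry bf' fd' bg' gd'].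
Qed.

Definition comeagre (T : topologicalType) (A : set T) : Prop :=
  exists2 F : nat -> set T,
    forall n, dense (interior (F n)) & A = \bigcap_n F n.

Definition qi_class (R : realType) (x : marked_space) : set marked_space :=
  [set y | marked_space_qi R x y].

Definition qi_diverse (R : realType) (S : set marked_space) : Prop :=
  forall A : set S, comeagre A ->
    [set qi_class R (val x) | x in A] #= [set: set nat].

(* Main.v *)
(* Being quasi-isometric through maps with constant C that move 1 by at most C is a
   closed relation on marked groups: lift the maps to words so that the image of each
   word stays in a finite set independent of the groups, and pass to an ultralimit.
   If such a relation contained a product U x V of non-empty open subsets of S, all
   groups in U would be quasi-isometric to those in V, hence to each other, against
   the hypothesis.  So quasi-isometry is a countable increasing union of nowhere dense
   relations on S, and Mycielski's construction of a Cantor scheme inside a given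
   comeagre set yields continuum many points that are pairwise not quasi-isometric.
   The scheme is built in one of the clopen slices G_n, where two points are close
   when they agree on all short words.  The upper bound holds since G has the
   cardinality of the continuum. *)
Require Import Defs.
From mathcomp Require Import all_boot all_order all_algebra.
From mathcomp Require Import all_classical all_reals all_analysis.
From mathcomp Require Import zify.

Set Implicit Arguments.
Unset Strict Implicit.
Unset Printing Implicit Defensive.

Import Order.TTheory GRing.Theory Num.Theory.

Local Open Scope classical_set_scope.

(** * Mycielski's theorem *)

Section Mycielski.
(** [E k x] acts as a basic neighbourhood of [x] of depth [k]; each [D n] contains a dense open set,
    and the [Q n] are increasing nowhere dense relations. *)
Variables (X : Type) (E : nat -> X -> X -> Prop).
Variables (D : nat -> X -> Prop) (Q : nat -> X -> X -> Prop).
Hypothesis E_refl : forall k x, E k x x.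
Hypothesis E_trans : forall k x y z, E k x y -> E k y z -> E k x z.
Hypothesis E_le : forall k l x y, (k <= l)%N -> E l x y -> E k x y.
Hypothesis E_lim : forall u : nat -> X, (forall k, E k (u k) (u k.+1)) ->
  exists x, forall k, E k (u k) x.
Hypothesis D_dense : forall n x k, exists y l,
  E k x y /\ forall z, E l y z -> D n z.
Hypothesis Q_le : forall m n x y, (m <= n)%N -> Q m x y -> Q n x y.
Hypothesis Q_nowhere_dense : forall n x y k, exists x' y' l,
  [/\ E k x x', E k y y' & forall z w, E l x' z -> E l y' w -> ~ Q n z w].

(** One depth [l] serves all coordinates, and [k <= l] lets refinements be iterated. *)
Definition dense_open (I : Type) (P : (I -> X) -> Prop) :=
  forall p k, exists p' l, [/\ (k <= l)%N, forall i, E k (p i) (p' i) &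
    forall q, (forall i, E l (p' i) (q i)) -> P q].

Lemma dense_open_impl (I : Type) (B : Prop) (P : (I -> X) -> Prop) :
  (B -> dense_open P) -> dense_open (fun q => B -> P q).
Proof.
move=> BP p k; have [/BP/(_ p k)|nB] := pselect B; last by exists p, k; split.
by move=> [p' [l [kl pp' p'P]]]; exists p', l; split=> // q /p'P.
Qed.

Lemma dense_open_and (I : Type) (P P' : (I -> X) -> Prop) :
  dense_open P -> dense_open P' -> dense_open (fun q => P q /\ P' q).
Proof.
move=> oP oP' p k; have [p1 [l1 [kl1 pp1 P1]]] := oP p k.
have [p2 [l2 [l12 p12 P2]]] := oP' p1 l1.
exists p2, l2; split; first exact: leq_trans l12.
  by move=> i; apply: E_trans (E_le kl1 (p12 i)).
move=> q p2q; split; last exact: P2.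
by apply: P1 => i; apply: E_trans (p12 i) (E_le l12 (p2q i)).
Qed.

Lemma dense_open_all (I : Type) (J : eqType) (s : seq J)
    (P : J -> (I -> X) -> Prop) :
  (forall j, dense_open (P j)) -> dense_open (fun q => forall j, j \in s -> P j q).
Proof.
move=> oP; elim: s => [|j s IH]; first by move=> p k; exists p, k; split.
move=> p k; have [p' [l [kl pp' p'P]]] := dense_open_and (oP j) IH p k.
exists p', l; split=> // q /p'P[Pj Ps] i; rewrite inE => /orP[/eqP->//|].
exact: Ps.
Qed.

Lemma dense_open_proj (I : eqType) n (i : I) : dense_open (fun q => D n (q i)).
Proof.
move=> p k; have [y [l [xy yD]]] := D_dense n (p i) k.
exists (fun j => if j == i then y else p j), (maxn k l); split.
- by rewrite leq_maxl.
- by move=> j; case: eqP => [->|].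
- move=> q /(_ i); rewrite eqxx => qE; apply: yD; apply: E_le qE.
  by rewrite leq_maxr.
Qed.

Lemma dense_open_pair (I : eqType) n (i j : I) :
  i != j -> dense_open (fun q => ~ Q n (q i) (q j)).
Proof.
move=> ij p k.
have [x [y [l [ix jy xyQ]]]] := Q_nowhere_dense n (p i) (p j) k.
exists (fun h => if h == i then x else if h == j then y else p h), (maxn k l).
split; first by rewrite leq_maxl.
  by move=> h; case: eqP => [->|_] //; case: eqP => [->|].
move=> q qE; apply: xyQ.
  by apply: E_le (leq_maxr k l) _; have := qE i; rewrite eqxx.
by apply: E_le (leq_maxr k l) _; have := qE j; rewrite eqxx eq_sym (negbTE ij).
Qed.

(** Step [k] leads from strings of length [k] to those of length [k.+1], hence the shift. Only
    finitely many strings are constrained. *)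
Let good k (q : seq bool -> X) := forall s t, size s = k.+1 -> size t = k.+1 ->
  D k (q s) /\ (s != t -> ~ Q k (q s) (q t)).

Lemma dense_open_good k : dense_open (good k).
Proof.
pose ts := enum {: k.+1.-tuple bool}.
have H := @dense_open_all (seq bool) _ [seq (s, t) | s <- ts, t <- ts]
  (fun st q => D k (q (tval st.1)) /\
     (tval st.1 != tval st.2 -> ~ Q k (q (tval st.1)) (q (tval st.2)))).
move=> p l; have [|p' [l' [ll' pp' p'P]]] := H _ p l.
  move=> [s t]; apply: dense_open_and; first exact: dense_open_proj.
  by apply: dense_open_impl => st; exact: dense_open_pair.
exists p', l'; split=> // q /p'P qP s t sk tk.
move: sk tk => /eqP sk /eqP tk.
apply: (qP (Tuple sk, Tuple tk)).
by apply/allpairsP; exists (Tuple sk, Tuple tk); rewrite !mem_enum.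
Qed.

(* At level k the state consists of points p s, for all s of length k, and a
   depth l; the balls of depth l around the p s form the k-th level of a Cantor
   scheme. *)
Lemma mycielski (x0 : X) : exists f : (nat -> bool) -> X,
  (forall a n, D n (f a)) /\ (forall a b n, a <> b -> ~ Q n (f a) (f b)).
Proof.
pose step (k : nat) (st st' : (seq bool -> X) * nat) :=
  [/\ (st.2 < st'.2)%N, forall s, E st.2 (st.1 (take k s)) (st'.1 s) &
   forall q, (forall s, E st'.2 (st'.1 s) (q s)) -> good k q].
have /choice[F FP] (kst : nat * ((seq bool -> X) * nat)) :
    exists st', step kst.1 kst.2 st'.
  case: kst => k [p l].
  (* Asking for depth [l.+1] makes the depths strictly increase; [take k s] is the parent of [s]. *)
  have [p' [l' [ll' pp' p'P]]] := dense_open_good k (fun s => p (take k s)) l.+1.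
  exists (p', l'); split=> //= s.
  exact: E_le (leqnSn l) (pp' s).
pose st := fix st k := if k is k'.+1 then F (k', st k') else (fun=> x0, 0%N).
have stP k : step k (st k) (st k.+1) by exact: (FP (k, st k)).
have stS k : ((st k).2 < (st k.+1).2)%N by case: (stP k).
have stle k m : (k <= m)%N -> ((st k).2 <= (st m).2)%N.
  by move=> km; apply: (@homo_leq _ (fun k => (st k).2) leq) => //;
    [exact: leq_trans|move=> i; exact: ltnW].
have stge k : (k <= (st k).2)%N.
  by elim: k => // k IH; apply: leq_ltn_trans IH _.
have /choice[f fP] (a : nat -> bool) :
    exists x, forall k, E (st k).2 ((st k).1 (mkseq a k)) x.
  pose u k := (st k).1 (mkseq a k).
  have uS k : E (st k).2 (u k) (u k.+1).
    have [_ + _] := stP k; move=> /(_ (mkseq a k.+1)).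
    by rewrite /mkseq -map_take take_iota (minn_idPl _).
  have [x ux] : exists x, forall k, E k (u k) x.
    by apply: E_lim => k; apply: E_le (uS k).
  (* The limit is only known to match [u k] to depth [k]; passing through [u m] with [m] at least
     the depth of level [k] recovers that full depth. *)
  exists x => k; pose m := maxn k (st k).2.
  have ukm j : (k <= j)%N -> E (st k).2 (u k) (u j).
    move=> /subnKC <-; elim: (j - k)%N => [|i IH]; first by rewrite addn0.
    by rewrite addnS; apply: E_trans IH (E_le _ (uS _)); apply/stle/leq_addr.
  apply: (E_trans (ukm m (leq_maxl _ _))).
  by apply: E_le (ux m); exact: leq_maxr.
(* Putting the limits of two branches into level [k] stays within the balls of that level, so [good]
   applies to the limits. *)
pose q k a b s := if s == mkseq a k then f a else
  if s == mkseq b k then f b else (st k).1 s.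
have qE k a b s : E (st k).2 ((st k).1 s) (q k a b s).
  by rewrite /q; case: eqP => [->|_] //; case: eqP => [->|].
have fgood k a b : D k (f a) /\
    (mkseq a k.+1 != mkseq b k.+1 -> ~ Q k (f a) (f b)).
  have [_ _ /(_ (q k.+1 a b))] := stP k.
  move=> /(_ (qE _ _ _)) /(_ (mkseq a k.+1) (mkseq b k.+1)).
  rewrite !size_mkseq => /(_ erefl erefl).
  by rewrite /q !eqxx eq_sym; case: eqP => [_ []|].
exists f; split=> [a n|a b n ab]; first by case: (fgood n a a).
have [j abj] : exists j, a j != b j.
  apply/not_existsP => abE; apply/ab/funext => j.
  by apply/eqP/negP => /negP; exact: abE.
(* Prefixes reaching beyond [j] differ, and avoiding [Q] at a larger index is stronger. *)
move=> /(Q_le (leq_maxl n j)); have [_] := fgood (maxn n j) a b; apply.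
apply: contraNneq abj => /(congr1 (fun s => nth (a j) s j)).
by rewrite !nth_mkseq ?ltnS ?leq_maxr // => ->.
Qed.
End Mycielski.

(** * Quasi-isometries and word lengths *)

Section MarkedDistance.
Local Open Scope group_scope.
Variables (n : nat) (N : marked n).
Implicit Types (x y z : marked_group N) (u v w : word 'I_n).

Definition ndist x y : nat := word_norm (marking N) (x^-1 * y).

Lemma ndist_le x y k : (ndist x y <= k)%N <->
  exists2 r, (size r <= k)%N & x * word_eval (marking N) r = y.
Proof.
rewrite /ndist; have [[w wE ws] wm] := word_normP (x^-1 * y) (@marking_generates _ N).
split=> [xyk|[r rk rE]]; first by exists w; rewrite ?ws // wE mulVKg.
by apply: leq_trans rk; apply: wm; rewrite -rE mulKg.
Qed.

Lemma ndistxx x : ndist x x = 0%N.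
Proof.
apply/eqP; rewrite -leqn0; apply/ndist_le; exists [::] => //.
by rewrite /word_eval big_nil mulg1.
Qed.

Lemma ndist_triangle y x z : (ndist x z <= ndist x y + ndist y z)%N.
Proof.
have [/(_ (leqnn _))[r rk ry] _] := ndist_le x y (ndist x y).
have [/(_ (leqnn _))[s sk sz] _] := ndist_le y z (ndist y z).
apply/ndist_le; exists (r ++ s); first by rewrite size_cat leq_add.
by rewrite word_eval_cat mulgA ry.
Qed.

Definition wdist u v := ndist (word_eval (marking N) u) (word_eval (marking N) v).

Lemma word_eval_marking w : word_eval (marking N) w = coset N (free_of_word w).
Proof. by rewrite -free_eval_marking free_eval_word. Qed.

(** A distance bound is witnessed by one word of bounded length and one membership in the kernel;
    this form passes to limits. *)
Lemma wdist_le u v k : (wdist u v <= k)%N <->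
  exists2 r, (size r <= k)%N & N ((free_of_word (u ++ r))^-1 * free_of_word v).
Proof.
rewrite /wdist; split=> [/ndist_le|] [r rk rE].
  by exists r => //; apply/coset_eqP; rewrite -!word_eval_marking word_eval_cat.
apply/ndist_le; exists r => //; rewrite -word_eval_cat !word_eval_marking.
exact/coset_eqP.
Qed.

End MarkedDistance.

Section QuasiIsometry.
Variables (n m : nat) (N : marked n) (M : marked m).

Definition nat_qi (C : nat) (phi : marked_group N -> marked_group M)
    (psi : marked_group M -> marked_group N) : Prop :=
  [/\ forall x y, (ndist (phi x) (phi y) <= C * ndist x y + C)%N,
      forall x y, (ndist (psi x) (psi y) <= C * ndist x y + C)%N,
      forall t, (ndist (phi (psi t)) t <= C)%N &
      forall s, (ndist (psi (phi s)) s <= C)%N].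

Lemma quasi_isometric_natP (R : realType) :
  quasi_isometric (@marked_dist R _ N) (@marked_dist R _ M) <->
  exists C phi psi, nat_qi C phi psi.
Proof.
split=> [[C [phi [psi [H1 H2 H3 H4]]]]|[C [phi [psi [H1 H2 H3 H4]]]]]; last first.
  exists (C%:R)%R, phi, psi.
  by split=> [x y|x y|t|s]; rewrite /marked_dist /word_dist -?natrM -?natrD ler_nat;
    [exact: H1|exact: H2|exact: H3|exact: H4].
pose c := Num.bound `|C|%R.
have Cc : (C <= c%:R)%R.
  by apply: le_trans (ler_norm _) _; apply/ltW/archi_boundP.
have le1 (k l : nat) : (k%:R <= C * l%:R + C :> R)%R -> (k <= c * l + c)%N.
  move=> kl; rewrite -(ler_nat R) natrD natrM (le_trans kl) //.
  by rewrite lerD // ler_wpM2r.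
have le2 (k : nat) : (k%:R <= C :> R)%R -> (k <= c)%N.
  by move=> kC; rewrite -(ler_nat R) (le_trans kC).
exists c, phi, psi.
by split=> [x y|x y|t|s]; [exact/le1/H1|exact/le1/H2|exact/le2/H3|exact/le2/H4].
Qed.

End QuasiIsometry.

Definition nqi n m (N : marked n) (M : marked m) : Prop :=
  exists C phi psi, @nat_qi n m N M C phi psi.

Lemma nqi_refl n (N : marked n) : nqi N N.
Proof.
by exists 1%N, id, id; split=> [x y|x y|x|x]; rewrite ?ndistxx // mul1n leq_addr.
Qed.

Lemma nqi_sym n m (N : marked n) (M : marked m) : nqi N M -> nqi M N.
Proof. by move=> [C [phi [psi [? ? ? ?]]]]; exists C, psi, phi; split. Qed.

Lemma nqi_trans n m k (N : marked n) (M : marked m) (L : marked k) :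
  nqi N M -> nqi M L -> nqi N L.
Proof.
move=> [C [f [g [f1 g1 fg gf]]]] [C' [f' [g' [f1' g1' fg' gf']]]].
(* The round trips move points by at most [C * C' + 2 * C'] and [C * C' + 2 * C]. *)
exists (C * C' + 2 * C + 2 * C')%N, (f' \o f), (g \o g'); split=> [x y|x y|t|s] /=.
- by have := f1' (f x) (f y); have := f1 x y; nia.
- by have := g1 (g' x) (g' y); have := g1' x y; nia.
- have := ndist_triangle (f' (g' t)) (f' (f (g (g' t)))) t.
  by have := f1' (f (g (g' t))) (g' t); have := fg (g' t); have := fg' t; nia.
- have := ndist_triangle (g (f s)) (g (g' (f' (f s)))) s.
  by have := g1 (g' (f' (f s))) (f s); have := gf' (f s); have := gf s; nia.
Qed.

(* A quasi-isometry lifted to words. The bounds on the sizes confine the images of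
   each word to a finite set depending only on C; they cost nothing, as C may
   depend on the distance of the images of 1 to 1. *)
Definition word_qi n m (C : nat) (N : marked n) (M : marked m)
    (phi : word 'I_n -> word 'I_m) (psi : word 'I_m -> word 'I_n) : Prop :=
  [/\ forall u v, (wdist M (phi u) (phi v) <= C * wdist N u v + C)%N,
      forall u v, (wdist N (psi u) (psi v) <= C * wdist M u v + C)%N,
      forall t, (wdist M (phi (psi t)) t <= C)%N,
      forall s, (wdist N (psi (phi s)) s <= C)%N &
      (forall u, size (phi u) <= C * size u + C)%N /\
      (forall u, size (psi u) <= C * size u + C)%N].

Lemma word_qi_le n m (N : marked n) (M : marked m) C C' phi psi :
  (C <= C')%N -> word_qi C N M phi psi -> word_qi C' N M phi psi.
Proof.
move=> CC' [H1 H2 H3 H4 [H5 H6]].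
have le k l : (k <= C * l + C -> k <= C' * l + C')%N.
  by move=> /leq_trans; apply; rewrite leq_add // leq_mul2r CC' orbT.
by split=> [u v|u v|t|s|]; [exact/le/H1|exact/le/H2|exact: leq_trans (H3 t) CC'|
  exact: leq_trans (H4 s) CC'|split=> u; [exact/le/H5|exact/le/H6]].
Qed.

(** The image of a word [w] is within [C * size w + C] of the image of the identity, so adding the
    displacement of the identity bounds the length of some representative. *)
Lemma nqi_word_qi n m (N : marked n) (M : marked m) :
  nqi N M -> exists C phi psi, word_qi C N M phi psi.
Proof.
move=> [C [f [g [f1 g1 fg gf]]]].
pose a := ndist 1%g (f 1%g); pose b := ndist 1%g (g 1%g).
have lift k (L : marked k) (h : marked_group L) K :
    (ndist 1%g h <= K)%N -> exists w, word_eval (marking L) w = h /\ (size w <= K)%N.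
  by move=> /ndist_le[r rK rh]; exists r; rewrite -[RHS]rh mul1g.
have norm_eval k (L : marked k) w : (ndist 1%g (word_eval (marking L) w) <= size w)%N.
  by apply/ndist_le; exists w; rewrite ?mul1g.
have fs w : (ndist 1%g (f (word_eval (marking N) w)) <= C * size w + C + a)%N.
  have := ndist_triangle (f 1%g) 1%g (f (word_eval (marking N) w)).
  have := f1 1%g (word_eval (marking N) w).
  by have := norm_eval _ N w; rewrite -/a; nia.
have gs w : (ndist 1%g (g (word_eval (marking M) w)) <= C * size w + C + b)%N.
  have := ndist_triangle (g 1%g) 1%g (g (word_eval (marking M) w)).
  have := g1 1%g (word_eval (marking M) w).
  by have := norm_eval _ M w; rewrite -/b; nia.
have /choice[phi phiP] w := lift _ _ _ _ (fs w).
have /choice[psi psiP] w := lift _ _ _ _ (gs w).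
have phiE u : word_eval (marking M) (phi u) = f (word_eval (marking N) u).
  by case: (phiP u).
have psiE u : word_eval (marking N) (psi u) = g (word_eval (marking M) u).
  by case: (psiP u).
exists (C + a + b)%N, phi, psi; split.
- move=> u v; rewrite /wdist !phiE.
  by have := f1 (word_eval (marking N) u) (word_eval (marking N) v); nia.
- move=> u v; rewrite /wdist !psiE.
  by have := g1 (word_eval (marking M) u) (word_eval (marking M) v); nia.
- by move=> t; rewrite /wdist phiE psiE; have := fg (word_eval (marking M) t); lia.
- by move=> s; rewrite /wdist psiE phiE; have := gf (word_eval (marking N) s); lia.
- by split=> u; [case: (phiP u) => _|case: (psiP u) => _]; nia.
Qed.

(** Words with the same value may have different images, but these lie within [C] of each other;
    choosing representatives thus costs one more [C]. *)
Lemma word_qi_nqi n m (N : marked n) (M : marked m) C phi psi :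
  word_qi C N M phi psi -> nqi N M.
Proof.
move=> [H1 H2 H3 H4 _].
have /choice[rN rNK] := @marking_generates _ N.
have /choice[rM rMK] := @marking_generates _ M.
pose f x := word_eval (marking M) (phi (rN x)).
pose g y := word_eval (marking N) (psi (rM y)).
exists (2 * C)%N, f, g; split.
- by move=> x y; have := H1 (rN x) (rN y); rewrite /wdist !rNK /f; nia.
- by move=> x y; have := H2 (rM x) (rM y); rewrite /wdist !rMK /g; nia.
- move=> t; have := H3 (rM t); have := H1 (rN (g t)) (psi (rM t)).
  rewrite /wdist rNK -/(g t) ndistxx rMK -/(f (g t)).
  have := ndist_triangle (word_eval (marking M) (phi (psi (rM t)))) (f (g t)) t; lia.
- move=> s; have := H4 (rN s); have := H2 (rM (f s)) (phi (rN s)).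
  rewrite /wdist rMK -/(f s) ndistxx rNK -/(g (f s)).
  have := ndist_triangle (word_eval (marking N) (psi (phi (rN s)))) (g (f s)) s; lia.
Qed.

(** * Ultralimits of quasi-isometries lifted to words *)

Lemma finite_words (I : finType) k :
  exists s : seq (word I), forall w, (size w <= k)%N -> w \in s.
Proof.
elim: k => [|k [s sP]]; first by exists [:: [::]] => -[].
exists ([::] :: [seq a :: w | a <- enum {: I * bool}, w <- s]) => -[|a w] //= wk.
by rewrite inE; apply/allpairsP; exists (a, w); rewrite mem_enum; split=> //; exact: sP.
Qed.

Section Ultralimit.
Variables (T : Type) (F : set_system T).
Hypothesis FU : UltraFilter F.

Lemma ultra_finite (U : eqType) (f : T -> U) (s : seq U) :
  F [set t | f t \in s] -> exists u, F [set t | f t = u].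
Proof.
elim: s => [/filter_ex[]//|u s IH Fs].
have [|Fu] := in_ultra_setVsetC [set t | f t = u] FU; first by exists u.
apply: IH; apply: filterS (filterI Fs Fu) => t /= [].
by rewrite inE => /orP[/eqP|].
Qed.

Lemma ultra_word (I : finType) (f : T -> word I) k :
  F [set t | (size (f t) <= k)%N] -> exists w, F [set t | f t = w].
Proof.
have [s sP] := finite_words I k.
by move=> Fk; apply: (@ultra_finite _ f s); apply: filterS Fk => t; exact: sP.
Qed.

(** A word witnessing the bound at [t] has length at most [k], so it is a fixed word [w] for
    [F]-almost all [t]; its single kernel membership then passes to [N]. *)
Lemma ultra_wdist n (Z : T -> marked n) (N : marked n) (f g : T -> word 'I_n) u v k :
  (forall x, F [set t | Z t x = N x]) ->
  F [set t | f t = u] -> F [set t | g t = v] ->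
  F [set t | (wdist (Z t) (f t) (g t) <= k)%N] -> (wdist N u v <= k)%N.
Proof.
move=> ZN Ff Fg Fk.
pose P t r := (size r <= k)%N /\
  Z t ((free_of_word (f t ++ r))^-1 * free_of_word (g t))%g.
(* The empty word is a placeholder where no witness exists. *)
have /choice[r rP] t : exists r, (exists r', P t r') -> P t r.
  by have [[r Pr]|nP] := pselect (exists r', P t r'); [exists r|exists [::]].
have {}rP : F [set t | P t (r t)].
  by apply: filterS Fk => t /wdist_le[r' r'k rE]; apply: rP; exists r'.
have [w Fw] : exists w, F [set t | r t = w].
  by apply: (@ultra_word _ _ k); apply: filterS rP => t [].
pose x := ((free_of_word (u ++ w))^-1 * free_of_word v)%g.
have /filter_ex[t [[[[rk Zx] rw] [fu gv]] Zt]] :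
    F ([set t | P t (r t)] `&` [set t | r t = w] `&`
      ([set t | f t = u] `&` [set t | g t = v]) `&` [set t | Z t x = N x]).
  by apply: filterI (ZN x); apply: filterI; apply: filterI.
by apply/wdist_le; exists w; [rewrite -rw|rewrite -/x -Zt /x -rw -fu -gv].
Qed.

(** A word realizing the distance in [N] still joins the two values in [Z t] for [F]-almost all
    [t]. *)
Lemma near_wdist n (Z : T -> marked n) (N : marked n) u v :
  (forall x, F [set t | Z t x = N x]) ->
  F [set t | (wdist (Z t) u v <= wdist N u v)%N].
Proof.
move=> ZN; have [/(_ (leqnn _))[r rk Nr] _] := wdist_le N u v (wdist N u v).
apply: filterS (ZN ((free_of_word (u ++ r))^-1 * free_of_word v)%g) => t Zt.
by apply/wdist_le; exists r; rewrite ?Zt.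
Qed.

(** The length bounds leave finitely many candidates for [phi t u] and [psi t u], so the ultrafilter
    selects one of each for every [u]. *)
Lemma word_qi_ultralimit n m (Z : T -> marked n) (W : T -> marked m)
    (N : marked n) (M : marked m) C phi psi :
  (forall x, F [set t | Z t x = N x]) -> (forall x, F [set t | W t x = M x]) ->
  (forall t, word_qi C (Z t) (W t) (phi t) (psi t)) ->
  exists phi' psi', word_qi C N M phi' psi'.
Proof.
move=> ZN WM qi.
have /choice[f fP] u : exists u', F [set t | phi t u = u'].
  apply: (@ultra_word _ _ (C * size u + C)); apply: filterE => t /=.
  by case: (qi t) => _ _ _ _ [].
have /choice[g gP] u : exists u', F [set t | psi t u = u'].
  apply: (@ultra_word _ _ (C * size u + C)); apply: filterE => t /=.
  by case: (qi t) => _ _ _ _ [].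
exists f, g; split.
- move=> u v; apply: (ultra_wdist WM (fP u) (fP v)).
  apply: filterS (near_wdist u v ZN) => t ZNt.
  case: (qi t) => /(_ u v) + _ _ _ _; move/leq_trans; apply.
  by rewrite leq_add2r leq_mul2l ZNt orbT.
- move=> u v; apply: (ultra_wdist ZN (gP u) (gP v)).
  apply: filterS (near_wdist u v WM) => t WMt.
  case: (qi t) => _ /(_ u v) + _ _ _; move/leq_trans; apply.
  by rewrite leq_add2r leq_mul2l WMt orbT.
- move=> u; apply: (ultra_wdist WM (f := fun t => phi t (psi t u)) (g := fun=> u)).
  + by apply: filterS (filterI (gP u) (fP (g u))) => t [<-].
  + by apply: filterE.
  + by apply: filterE => t /=; case: (qi t).
- move=> u; apply: (ultra_wdist ZN (f := fun t => psi t (phi t u)) (g := fun=> u)).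
  + by apply: filterS (filterI (fP u) (gP (f u))) => t [<-].
  + by apply: filterE.
  + by apply: filterE => t /=; case: (qi t).
- split=> u.
    have /filter_ex[t <-] := fP u.
    by case: (qi t) => _ _ _ _ [].
  have /filter_ex[t <-] := gP u.
  by case: (qi t) => _ _ _ _ [].
Qed.

End Ultralimit.

(** * The slices of the space of marked groups *)

Section Balls.
Variable n : nat.
Implicit Types N M : marked n.

Definition agree k N M : Prop :=
  forall w : word 'I_n, (size w <= k)%N -> N (free_of_word w) = M (free_of_word w).

Lemma agree_le k l N M : (k <= l)%N -> agree l N M -> agree k N M.
Proof. by move=> kl NM w wk; apply/NM/(leq_trans wk). Qed.

Lemma agree_trans k N M L : agree k N M -> agree k M L -> agree k N L.
Proof. by move=> NM ML w wk; rewrite NM ?ML. Qed.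

Lemma agree_open k N : open [set M | agree k N M].
Proof.
rewrite openE => M /= NM; rewrite /interior.
have [s sP] := finite_words 'I_n k.
suff : nbhs M [set L : marked n |
    forall w, w \in s -> M (free_of_word w) = L (free_of_word w)].
  by apply: filterS => L ML; apply: agree_trans NM _ => w /sP; exact: ML.
elim: s {sP} => [|w s IH]; first exact: filterE.
have cw : nbhs M [set L : marked n | L (free_of_word w) = M (free_of_word w)].
  exact: (@continuous_nsub _ (free_of_word w) M [set b | b = M (free_of_word w)]).
apply: filterS (filterI cw IH) => L /= [Lw Ls] v.
by rewrite inE => /orP[/eqP->|]; [rewrite Lw|exact: Ls].
Qed.

(** The sets [A k] generate a filter converging pointwise to [N], since each group element has a
    representative of finite length. *)
Lemma nbhs_agree N (U : set (marked n)) :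
  nbhs N U -> exists k, forall M, agree k N M -> U M.
Proof.
rewrite nbhsE => -[B [[V oV VB] BN] BU].
pose A k : set {ptws free_group 'I_n -> bool} :=
  [set g | forall w, (size w <= k)%N -> N (free_of_word w) = g (free_of_word w)].
pose F := filter_from [set: nat] A.
have FF : Filter F.
  apply: filter_from_filter; first by exists 0%N.
  move=> k l _ _; exists (maxn k l) => // g Ag; split=> w wk; apply: Ag;
    by rewrite (leq_trans wk) // ?leq_maxl ?leq_maxr.
have FN : F --> (nsub N : {ptws free_group 'I_n -> bool}).
  apply/cvg_sup => x W; rewrite nbhsE => -[W' [[P oP PW] WN] WW].
  exists (size (repr x)) => // g /(_ _ (leqnn _)).
  rewrite free_of_wordK => gx; apply: WW; rewrite -PW /= -gx.
  by move: WN; rewrite -PW.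
have [|k _ kV] := FN V.
  by apply: open_nbhs_nbhs; split=> //; move: BN; rewrite -VB.
by exists k => M NM; apply: BU; rewrite -VB; exact: kV.
Qed.

(** Membership of [x] is constant from index [len x] on; each closure axiom involves finitely many
    elements and is inherited from a late [u m]. *)
Lemma agree_complete (u : nat -> marked n) :
  (forall k, agree k (u k) (u k.+1)) -> exists N, forall k, agree k (u k) N.
Proof.
move=> uS.
have uD k m : (k <= m)%N -> agree k (u k) (u m).
  move=> /subnKC <-; elim: (m - k)%N => [|i IH]; first by rewrite addn0.
  by rewrite addnS; apply: agree_trans IH (agree_le (leq_addr _ _) (uS _)).
pose len (x : free_group 'I_n) := size (repr x).
pose f x := u (len x) x.
have fE x m : (len x <= m)%N -> f x = u m x.
  by move=> /uD /(_ (repr x) (leqnn _)); rewrite free_of_wordK.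
have f1 : f 1%g by exact: nsub1.
have fM x y : f x -> f y -> f (x * y)%g.
  pose m := (len x + len y + len (x * y)%g)%N.
  by rewrite !(fE _ m) /m; [exact: nsubM|lia|lia|lia].
have fV x : f x -> f x^-1%g.
  pose m := (len x + len x^-1%g)%N.
  by rewrite !(fE _ m) /m; [exact: nsubV|lia|lia].
have fJ x y : f x -> f (x ^ y)%g.
  pose m := (len x + len (x ^ y)%g)%N.
  by rewrite !(fE _ m) /m; [exact: nsubJ|lia|lia].
exists (NormalSubgroup f1 fM fV fJ) => k w wk /=.
rewrite (fE _ (maxn k (len (free_of_word w)))) ?leq_maxr //.
by apply: uD; rewrite ?leq_maxl.
Qed.

End Balls.

(** * Coding marked groups by sets of natural numbers *)

Definition code (x : marked_space) : set nat :=
  let: existT n N := repr x in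
  [set k | exists2 w : word 'I_n.+1, k = pickle (n, pickle w) & N (free_of_word w)].

Lemma code_inj : injective code.
Proof.
move=> x y; rewrite /code => xy.
rewrite -[LHS]embed_repr -[RHS]embed_repr; move: xy.
case: (repr x) (repr y) => n N [m M] /= /seteqP[NM MN].
(* The empty word always lies in the kernel, so the code reveals [n]. *)
have nm : n = m.
  have [|w] := NM (pickle (n, pickle ([::] : word 'I_n.+1))).
    by exists [::] => //; exact: nsub1.
  by move=> /(pcan_inj pickleK)[].
subst m; congr embed; apply: normal_subgroupP => g; rewrite -(free_of_wordK g).
apply/idP/idP => H.
  have [|w] := NM (pickle (n, pickle (repr g))); first by exists (repr g).
  by move=> /(pcan_inj pickleK)[/(pcan_inj pickleK)->].
have [|w] := MN (pickle (n, pickle (repr g))); first by exists (repr g).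
by move=> /(pcan_inj pickleK)[/(pcan_inj pickleK)->].
Qed.

(** Otherwise every depth [l] offers a counterexample, and their ultralimit along a free ultrafilter
    is a quasi-isometry between [N] and [M]. *)
Lemma word_qi_closed n m (N : marked n) (M : marked m) C : ~ nqi N M ->
  exists l, forall N' M' phi psi,
    agree l N N' -> agree l M M' -> ~ word_qi C N' M' phi psi.
Proof.
move=> NM; apply: contra_notP NM => /forallNP nl.
have /choice[t tP] l : exists t : (marked n * marked m) *
    ((word 'I_n -> word 'I_m) * (word 'I_m -> word 'I_n)),
    [/\ agree l N t.1.1, agree l M t.1.2 & word_qi C t.1.1 t.1.2 t.2.1 t.2.2].
  apply: contrapT => /forallNP nt; apply: (nl l) => N' M' phi psi NN MM qi.
  exact: (nt ((N', M'), (phi, psi))).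
have [F [FU Foo]] := ultraFilterLemma (eventually_filter : ProperFilter \oo).
have lim k (L : marked k) (Z : nat -> marked k) :
    (forall l, agree l L (Z l)) -> forall x, F [set l | Z l x = L x].
  move=> LZ x; apply: Foo; exists (size (repr x)) => // l /= xl.
  by have := LZ l (repr x) xl; rewrite free_of_wordK.
have [|||phi [psi qi]] := @word_qi_ultralimit _ F FU _ _ (fun l => (t l).1.1)
  (fun l => (t l).1.2) N M C (fun l => (t l).2.1) (fun l => (t l).2.2).
- by apply: lim => l; case: (tP l).
- by apply: lim => l; case: (tP l).
- by move=> l; case: (tP l).
- exact: word_qi_nqi qi.
Qed.

(** * Nowhere density of quasi-isometry on a slice of [S] *)

Section Slice.
Variables (R : realType) (S : set marked_space).
Hypothesis S_closed : closed S.
Hypothesis S_diverse : forall U : set S, open U -> U !=set0 ->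
  exists x y : S, [/\ U x, U y & ~ marked_space_qi R (val x) (val y)].
Variable n : nat.

Let X := {N : marked n.+1 | S (embed N)}.
Let pt (x : X) : S := exist _ (embed (sval x)) (mem_set (svalP x)).

Lemma slice_complete (u : nat -> X) :
  (forall k, agree k (sval (u k)) (sval (u k.+1))) ->
  exists x : X, forall k, agree k (sval (u k)) (sval x).
Proof.
move=> /agree_complete[N uN].
have SN : S (embed N).
  apply: S_closed => B /embed_continuous/nbhs_agree[k kB].
  exists (embed (sval (u k))); split; first exact: (svalP (u k)).
  by apply: kB => w wk; rewrite uN.
by exists (exist _ N SN).
Qed.

(** Open in all of [S], not just in the slice, because [embed] is an open map; thus the diversity
    hypothesis applies to it. *)
Let ball k (x : X) : set S := val @^-1` (@embed n @` [set M | agree k (sval x) M]).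

Lemma ball_open k x : open (ball k x).
Proof.
have : continuous (val : S -> marked_space) by exact: initial_continuous.
by move=> /continuousP; apply; exact/embed_open/agree_open.
Qed.

Lemma ball_pt k x : ball k x (pt x).
Proof. by exists (sval x). Qed.

Lemma ballP k x y : ball k x y -> exists2 z : X, y = pt z & agree k (sval x) (sval z).
Proof.
move=> [M xM My]; have SM : S (embed M) by rewrite My; exact: set_mem (valP y).
by exists (exist _ M SM) => //; apply: val_inj; rewrite /= My.
Qed.

Lemma open_agree (U : set S) x : open U -> U (pt x) ->
  exists k, forall z : X, agree k (sval x) (sval z) -> U (pt z).
Proof.
move=> [W oW WU] Ux.
have [|k kW] := @nbhs_agree _ (sval x) (@embed n @^-1` W).
  apply: embed_continuous; apply: open_nbhs_nbhs; split=> //.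
  by move: Ux; rewrite -WU.
by exists k => z xz; rewrite -WU; exact: (kW _ xz).
Qed.

Lemma qi_nqi (x y : X) :
  marked_space_qi R (val (pt x)) (val (pt y)) <-> nqi (sval x) (sval y).
Proof. by rewrite marked_space_qiE quasi_isometric_natP. Qed.

(** Only [x] is moved: two points near [x] that are not quasi-isometric cannot both be
    quasi-isometric to [y]. *)
Lemma slice_qi_nowhere_dense C (x y : X) k : exists (x' y' : X) l,
  [/\ agree k (sval x) (sval x'), agree k (sval y) (sval y') &
    forall z w : X, agree l (sval x') (sval z) -> agree l (sval y') (sval w) ->
      ~ exists phi psi, word_qi C (sval z) (sval w) phi psi].
Proof.
suff [x' xx' nqi_x'y] : exists2 x' : X, agree k (sval x) (sval x') &
    ~ nqi (sval x') (sval y).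
  have [l lP] := word_qi_closed C nqi_x'y.
  by exists x', y, l; split=> // z w xz yw [phi [psi]]; exact: lP.
have [|x1 [x2 [/ballP[z1 -> xz1] /ballP[z2 -> xz2]]]] := S_diverse (ball_open k x).
  by exists (pt x); exact: ball_pt.
rewrite qi_nqi => nz.
have [z1y|] := pselect (nqi (sval z1) (sval y)); last by exists z1.
exists z2 => // z2y; apply: nz; exact: nqi_trans z1y (nqi_sym z2y).
Qed.

Lemma comeagre_transversal (A : set S) (x0 : X) : comeagre A ->
  exists f : (nat -> bool) -> S, (forall a, A (f a)) /\
    forall a b, a <> b -> ~ marked_space_qi R (val (f a)) (val (f b)).
Proof.
move=> [F Fd AF].
(* Depth is agreement on short words, the dense open sets are the interiors of the [F k], and the
   constant [C] indexes the relations. *)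
have [|||||||f [fD fQ]] := @mycielski X (fun k x y => agree k (sval x) (sval y))
  (fun k x => (F k)^° (pt x))
  (fun C x y => exists phi psi, word_qi C (sval x) (sval y) phi psi) _ _ _ _ _ _ _ x0.
- by move=> k x w.
- by move=> k x y z; exact: agree_trans.
- by move=> k l x y; exact: agree_le.
- exact: slice_complete.
- move=> k x l.
  have [|y [/ballP[z -> xz] Fz]] := Fd k (ball l x) _ (ball_open l x).
    by exists (pt x); exact: ball_pt.
  have [l' l'P] := open_agree (open_interior _) Fz.
  by exists z, l'.
- move=> C C' x y CC' [phi [psi qi]]; exists phi, psi; exact: word_qi_le qi.
- exact: slice_qi_nowhere_dense.
exists (pt \o f); split=> [a|a b ab].
  by rewrite AF => k _; apply: interior_subset; exact: fD.
by move=> /qi_nqi/nqi_word_qi[C]; exact: fQ ab.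
Qed.

End Slice.

(** * Counting the quasi-isometry classes *)

Theorem theorem1p1 (R : realType) (S : set marked_space) :
  S !=set0 -> closed S ->
  (forall U : set S, open U -> U !=set0 ->
    exists x y : S, [/\ U x, U y & ~ marked_space_qi R (val x) (val y)]) ->
  qi_diverse R S.
Proof.
move=> [x0 Sx0] S_closed S_diverse A A_comeagre.
(* A representative of [x0] singles out a slice that meets [S]. *)
have Sx : S (embed (projT2 (repr x0))) by rewrite embed_repr.
have [f [fA fqi]] := comeagre_transversal S_closed S_diverse
  (exist (fun N => S (embed N)) _ Sx) A_comeagre.
apply/card_eqPle; split.
  (* Upper bound: there are no more classes than points of [A], and [code] injects these into the
     sets of naturals. *)
  apply: (card_le_trans (card_image_le _ _)).
  apply/pcard_injP; exists (code \o val) => x y _ _ /code_inj; exact: val_inj.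
(* Lower bound: each set of naturals, read as a branch of the Cantor scheme, gives its own class. *)
pose g (B : set nat) := qi_class R (val (f (fun k => `[< B k >]))).
have gI : injective g.
  move=> B B' gBB'; apply: contrapT => BB'.
  apply: (fqi (fun k => `[< B k >]) (fun k => `[< B' k >])).
    move=> e; apply: BB'; apply/funext => k; apply/propext.
    by move: e => /(congr1 (@^~ k)) /= e; exact: asbool_eq_equiv e.
  suff : g B (val (f (fun k => `[< B' k >]))) by [].
  rewrite gBB' /g /qi_class /= /marked_space_qi.
  apply/quasi_isometric_natP; exact: nqi_refl.
apply: (@card_le_trans _ _ _ (range g)).
  by have /card_eqPle[] := inj_card_eq (A := setT) (in2W gI).
by apply: subset_card_le => _ [B _ <-]; exists (f (fun k => `[< B k >])).
Qed.
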